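(* A target pair $(H_w,H_r)$ satisfying dominance is realizable under either of the following conditions: (A) $b_r\le b_w$ and the multiset of remainder slopes $\{\rho_1,\dots,\rho_{b_r}\}$ is a submultiset of the multiset of larger slopes $\{h_1,\dots,h_{b_w}\}$. (B) $b_r\ge b_w-1$ and $h_n\le\rho_{n-1}$ for $2\le n\le b_w$.
   Context: An instance consists of a finite set $E$ of items with rational values $a_i\ge 0$, positive integer sizes $d_i$, and integer capacities $0\le R<D$, with $d_i\le D$ for every item. Write $G(S)=\sum_{i\in S}a_i$ and $d(S)=\sum_{i\in S}d_i$. For $\alpha\in\{w,r\}$ let $U^\alpha(n)$ be the maximum of $G(S)$ over $n$-element sets $S\subseteq E$ with $d(S)\le D$ (for $\alpha=w$) or $d(S)\le R$ (for $\alpha=r$), with value $-\infty$ if there is none; $U^\alpha(0)=0$. The terminal count is $b_\alpha=\min\operatorname{arg\,max}_n U^\alpha(n)$. The hull is the sequence on $\{0,\dots,b_\alpha\}$ obtained by evaluating at integers the upper concave hull of the points $(n,U^\alpha(n))$, $0\le n\le b_\alpha$. A target pair $(H_w,H_r)$ consists of strictly increasing concave rational sequences $H_\alpha$ on $\{0,\dots,b_\alpha\}$ with $H_\alpha(0)=0$ (the zero sequence $(0)$, with $b_\alpha=0$, is allowed). It is realizable if a single instance has terminal counts $b_w,b_r$ and hulls exactly $H_w$ and $H_r$. There is no cardinality cap. Notation. $h_n=H_w(n)-H_w(n-1)$, $\rho_m=H_r(m)-H_r(m-1)$. Dominance means $H_r(k)\le H_w(\min\{k,b_w\})$ for $0\le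 k\le b_r$. *)

(* Defs.v *)
From mathcomp Require Import all_boot all_order all_algebra.
From mathcomp Require Import finmap multiset.
From mathcomp Require Import constructive_ereal.

Set Implicit Arguments.
Unset Strict Implicit.
Unset Printing Implicit Defensive.

Import Order.TTheory GRing.Theory Num.Theory.
Local Open Scope mset_scope.
Local Open Scope ring_scope.

Record instance := Instance {
  item : finType;
  value : item -> rat;
  weight : item -> nat;
  capR : nat;
  capD : nat;
  value_ge0 : forall i, 0 <= value i;
  weight_gt0 : forall i, (0 < weight i)%N;
  capR_ltD : (capR < capD)%N;
  weight_leD : forall i, (weight i <= capD)%N }.

Definition total_value (I : instance) (S : {set item I}) : rat :=
  \sum_(i in S) value i.

Definition total_weight (I : instance) (S : {set item I}) : nat :=
  (\sum_(i in S) weight i)%N.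

(* The capacity C is capD I for the larger problem (w) and capR I for the
   remainder problem (r). *)
Definition U (I : instance) (C n : nat) : \bar rat :=
  \big[maxe/-oo%E]_(S : {set item I} | (#|S| == n) && (total_weight S <= C)%N)
     (total_value S)%:E.

Definition is_argmax (u : nat -> \bar rat) (n : nat) : Prop :=
  forall m : nat, (u m <= u n)%E.

Definition is_terminal_count (u : nat -> \bar rat) (b : nat) : Prop :=
  is_argmax u b /\ forall n : nat, is_argmax u n -> (b <= n)%N.

(* l lists the coefficients of a convex combination of points with abscissas
   0, ..., b; the combination has abscissa x. *)
Definition convex_weights (b : nat) (x : rat) (l : 'I_b.+1 -> rat) : Prop :=
  [/\ forall i, 0 <= l i, \sum_i l i = 1 & \sum_i l i * (i : nat)%:R = x].

(* v is the ordinate at abscissa x of the upper boundary of the convex hull of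
   the points (n, u n), 0 <= n <= b. Since 0 * -oo = 0, a point at height -oo
   contributes nothing when its coefficient is 0. *)
Definition upper_hull_at (u : nat -> \bar rat) (b : nat) (x v : rat) : Prop :=
  (exists2 l : 'I_b.+1 -> rat,
     convex_weights x l & (\sum_(i < b.+1) (l i)%:E * u i)%E = v%:E) /\
  (forall l : 'I_b.+1 -> rat,
     convex_weights x l -> (\sum_(i < b.+1) (l i)%:E * u i <= v%:E)%E).

(* A sequence on {0, ..., b} is a function on nat of which only the values at
   0, ..., b are ever constrained or used. *)
Definition is_hull (u : nat -> \bar rat) (b : nat) (H : nat -> rat) : Prop :=
  forall n : nat, (n <= b)%N -> upper_hull_at u b n%:R (H n).

(* Meaningful for 1 <= n only. *)
Definition slope (H : nat -> rat) (n : nat) : rat := H n - H n.-1.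

Definition is_target (b : nat) (H : nat -> rat) : Prop :=
  [/\ H 0%N = 0,
      forall n : nat, (n < b)%N -> H n < H n.+1
    & forall n : nat, (0 < n < b)%N -> slope H n.+1 <= slope H n].

Definition realizable (bw br : nat) (Hw Hr : nat -> rat) : Prop :=
  exists I : instance,
    [/\ is_terminal_count (U I (capD I)) bw,
        is_terminal_count (U I (capR I)) br,
        is_hull (U I (capD I)) bw Hw
      & is_hull (U I (capR I)) br Hr].

Definition dominance (bw br : nat) (Hw Hr : nat -> rat) : Prop :=
  forall k : nat, (k <= br)%N -> Hr k <= Hw (minn k bw).

Definition slopes (b : nat) (H : nat -> rat) : {mset rat} :=
  seq_mset [seq slope H n | n <- iota 1 b].

Definition conditionA (bw br : nat) (Hw Hr : nat -> rat) : Prop :=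
  (br <= bw)%N /\ (slopes br Hr `<=` slopes bw Hw)%mset.

(* Truncated subtraction is harmless: for bw = 0 the first conjunct is vacuous
   over the integers as well. *)
Definition conditionB (bw br : nat) (Hw Hr : nat -> rat) : Prop :=
  (bw - 1 <= br)%N /\
  forall n : nat, (2 <= n <= bw)%N -> slope Hw n <= slope Hr n.-1.

(* Main.v *)
Require Import Defs.
From mathcomp Require Import all_boot all_order all_algebra.
From mathcomp Require Import finmap multiset.
From mathcomp Require Import constructive_ereal.
From mathcomp Require Import zify ring lra.

(** Under either condition an instance can be built whose optimal values U(n)
    are equal to H(n) for all n <= b, for both capacities at once. A concave
    sequence is its own upper hull, and a strictly increasing one has its last
    index as terminal count, so this is enough. [profile_of_bounds] turns the
    claim into two elementary checks on item sets S: feasible sets satisfy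
    G(S) <= H(min(#|S|, b)), and every H(n) with n <= b is attained.

    The common tool is [concave_support]: for a threshold slope s at n, keeping
    the increments that exceed s is optimal, so k increments of a concave H add
    up to at most H(n) + s (k - n). With k = n this says that the best k
    increments are the first k; applied to prefixes it gives the supporting
    line that proves Jensen's inequality.

    (A) Take one item for each h_n, and choose an injection j with
    rho_m = h_(j m). The items in the image of j have size 1 and the others are
    too large for R = b_r, while D holds everything. Then w chooses freely among
    the h_n and r freely among the rho_m.

    (B) Take b_r unit items of values rho_m, with R = b_r, and for each n < b_w
    one large item of value g_n = H_w(n+1) - H_r(n) and size D - n, where D is
    large enough that no large item fits in R and no two of them fit in D. Large
    item n leaves room for exactly n unit items, the best of which complete it
    to H_w(n+1). The condition on slopes says that g is nonincreasing, so
    stopping at k <= n unit items gives at most g_k + H_r(k) = H_w(k+1); sets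
    without large item are controlled by dominance. *)

Set Implicit Arguments.
Unset Strict Implicit.
Unset Printing Implicit Defensive.

Import Order.TTheory GRing.Theory Num.Theory.
Local Open Scope ring_scope.

(** * Concave sequences *)

Definition prefix_set (b n : nat) : {set 'I_b} := [set i : 'I_b | (i < n)%N].

Lemma big_prefix (R : Type) (idx : R) (op : Monoid.com_law idx) (b n : nat)
    (F : nat -> R) :
  (n <= b)%N ->
  \big[op/idx]_(i in prefix_set b n) F i = \big[op/idx]_(i < n) F i.
Proof.
move=> le_nb; rewrite (big_ord_widen b F le_nb).
by apply: eq_bigl => i; rewrite inE.
Qed.

Lemma card_prefix b n : (n <= b)%N -> #|prefix_set b n| = n.
Proof.
move=> le_nb.
by rewrite -sum1_card (big_prefix _ (fun=> 1%N) le_nb) sum1_card card_ord.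
Qed.

Lemma sum_slope (H : nat -> rat) n :
  H 0%N = 0 -> \sum_(i < n) slope H i.+1 = H n.
Proof.
move=> H0; elim: n => [|n IHn]; first by rewrite big_ord0.
by rewrite big_ord_recr /= IHn /slope /=; ring.
Qed.

Lemma sum_slope_prefix (H : nat -> rat) b n :
  H 0%N = 0 -> (n <= b)%N -> \sum_(i in prefix_set b n) slope H i.+1 = H n.
Proof.
move=> H0 le_nb.
by rewrite (big_prefix _ (fun i => slope H i.+1) le_nb) sum_slope.
Qed.

Lemma slope_ge0 b H n : is_target b H -> (n < b)%N -> 0 <= slope H n.+1.
Proof. by case=> _ incH _ lt_nb; rewrite subr_ge0 ltW ?incH. Qed.

Lemma target_mono b H m n :
  is_target b H -> (m <= n <= b)%N -> H m <= H n.
Proof.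
case=> _ incH _ /andP[le_mn]; elim: n le_mn => [|n IHn] le_mn le_nb.
  by move: le_mn; rewrite leqn0 => /eqP ->.
move: le_mn; rewrite leq_eqVlt => /predU1P[-> //|le_mn].
by apply: le_trans (IHn le_mn (ltnW le_nb)) (ltW (incH _ le_nb)).
Qed.

Lemma slope_antitone b H m n :
  is_target b H -> (0 < m <= n)%N -> (n <= b)%N -> slope H n <= slope H m.
Proof.
case=> _ _ conH /andP[m_gt0 le_mn]; elim: n le_mn => [|n IHn] le_mn le_nb.
  by move: le_mn; rewrite leqn0 => /eqP ->.
move: le_mn; rewrite leq_eqVlt => /predU1P[-> //|le_mn].
apply: le_trans (conH n _) (IHn le_mn (ltnW le_nb)).
by rewrite le_nb andbT (leq_trans m_gt0).
Qed.

(** Subtract the threshold s from each increment: those of index at most n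
    become nonnegative and the later ones nonpositive, so the best choice is
    to keep exactly the first n, whatever the number of terms of the sum. *)
Lemma concave_support b H n :
  is_target b H -> (n <= b)%N ->
  exists s : rat, forall S : {set 'I_b},
    \sum_(i in S) slope H i.+1 <= H n + s * (#|S|%:R - n%:R).
Proof.
move=> tH le_nb; have [H0 _ _] := tH.
(* For n = 0 there is no slope on the left: the first one serves as well. *)
pose s := slope H (maxn n 1); exists s => S.
have early (i : nat) : (i < n)%N -> 0 <= slope H i.+1 - s.
  by move=> lt_in; rewrite subr_ge0; apply: (slope_antitone tH); lia.
have late (i : nat) : (n <= i < b)%N -> slope H i.+1 - s <= 0.
  by move=> i_late; rewrite subr_le0; apply: (slope_antitone tH); lia.
have: \sum_(i in S) (slope H i.+1 - s)
        <= \sum_(i in prefix_set b n) (slope H i.+1 - s).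
  rewrite big_mkcond [leRHS]big_mkcond; apply: ler_sum => i _; rewrite inE.
  have := ltn_ord i; case: (ltnP i n) => [lt_in _|le_ni lt_ib].
    by case: ifP => // _; apply: early.
  by case: ifP => // _; apply: late; rewrite le_ni.
rewrite sumrB [leRHS]sumrB sum_slope_prefix // !sumr_const card_prefix //.
by rewrite -!(mulr_natr s); lra.
Qed.

Lemma greedy_bound b H (S : {set 'I_b}) :
  is_target b H -> \sum_(i in S) slope H i.+1 <= H #|S|.
Proof.
move=> tH; have le_Sb : (#|S| <= b)%N by rewrite -[leqRHS]card_ord max_card.
have [s /(_ S)] := concave_support tH le_Sb.
by rewrite subrr mulr0 addr0.
Qed.

(** A supporting line at n, given by [concave_support] on prefixes, dominates H
    at every index and averages to H n. *)
Lemma concave_jensen b H n (l : 'I_b.+1 -> rat) :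
  is_target b H -> (n <= b)%N -> convex_weights n%:R l ->
  \sum_i l i * H i <= H n.
Proof.
move=> tH le_nb [l_ge0 l_sum1 l_mean]; have [H0 _ _] := tH.
have [s supp] := concave_support tH le_nb.
have line (i : nat) : (i <= b)%N -> H i <= H n + s * (i%:R - n%:R).
  move=> le_ib; have := supp (prefix_set b i).
  by rewrite sum_slope_prefix // card_prefix.
apply: (@le_trans _ _ (\sum_i (l i * (H n - s * n%:R) + s * (l i * i%:R)))).
  apply: ler_sum => i _.
  have -> : l i * (H n - s * n%:R) + s * (l i * i%:R)
            = l i * (H n + s * (i%:R - n%:R)) by ring.
  by apply: ler_wpM2l => //; apply: line; rewrite -ltnS.
by rewrite big_split /= -mulr_suml -mulr_sumr l_sum1 l_mean; lra.
Qed.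

(** * From exact values to terminal count and hull *)

Lemma terminal_count_exact b H (u : nat -> \bar rat) :
  is_target b H -> (forall n, (n <= b)%N -> u n = (H n)%:E) ->
  (forall n, (u n <= (H (minn n b))%:E)%E) -> is_terminal_count u b.
Proof.
move=> tH uH u_le; split=> [m|n argmax_n].
  rewrite (uH b) //; apply: le_trans (u_le m) _.
  by rewrite lee_fin (target_mono tH) // geq_minr leqnn.
rewrite leqNgt; apply/negP => lt_nb; have [_ incH _] := tH.
have := argmax_n n.+1; rewrite (uH n) ?(uH n.+1) ?(ltnW lt_nb) //.
by rewrite lee_fin leNgt incH.
Qed.

Lemma hull_exact b H (u : nat -> \bar rat) :
  is_target b H -> (forall n, (n <= b)%N -> u n = (H n)%:E) -> is_hull u b H.
Proof.
move=> tH uH n le_nb.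
have combE (l : 'I_b.+1 -> rat) :
    (\sum_(i < b.+1) (l i)%:E * u i)%E = (\sum_i l i * H i)%:E.
  rewrite -sumEFin; apply: eq_bigr => i _.
  by rewrite uH ?EFinM // -ltnS.
split=> [|l l_conv]; last by rewrite combE lee_fin (concave_jensen tH).
have sum_delta (F : nat -> rat) :
    \sum_(i < b.+1) (i == n :> nat)%:R * F i = F n.
  rewrite (bigD1 (Ordinal (le_nb : n < b.+1)%N)) //= eqxx mul1r.
  rewrite big1 ?addr0 // => i; rewrite -val_eqE /= => /negPf ->.
  by rewrite mul0r.
exists (fun i => (i == n :> nat)%:R); last by rewrite combE sum_delta.
split=> [i||]; first exact: ler0n.
  by rewrite -[RHS](sum_delta (fun=> 1)); apply: eq_bigr => i _; rewrite mulr1.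
exact: (sum_delta (fun i => i%:R)).
Qed.

(** The truncation in H (minn #|S| b) also covers sets of more than b items:
    they never beat H b, hence do not move the smallest maximizer. *)
Lemma profile_of_bounds (I : instance) C b H :
  is_target b H ->
  (forall S : {set item I}, (total_weight S <= C)%N ->
     total_value S <= H (minn #|S| b)) ->
  (forall n, (n <= b)%N -> exists S : {set item I},
     [/\ #|S| = n, (total_weight S <= C)%N & total_value S = H n]) ->
  is_terminal_count (U I C) b /\ is_hull (U I C) b H.
Proof.
move=> tH bound attain.
have U_le n : (U I C n <= (H (minn n b))%:E)%E.
  apply/bigmax_leP; split=> [|S /andP[/eqP <- feasible]]; first exact: leNye.
  by rewrite lee_fin bound.
have U_eq n : (n <= b)%N -> U I C n = (H n)%:E.
  move=> le_nb; apply/le_anti; have := U_le n.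
  rewrite (minn_idPl le_nb) => -> /=.
  have [S [cardS feasible <-]] := attain n le_nb.
  apply: (le_bigmax_cond _ (fun S : {set item I} => (total_value S)%:E)).
  by rewrite cardS eqxx.
by split; [apply: (terminal_count_exact tH) | apply: hull_exact].
Qed.

Lemma realizable_of_profiles (I : instance) bw br Hw Hr :
  is_terminal_count (U I (capD I)) bw /\ is_hull (U I (capD I)) bw Hw ->
  is_terminal_count (U I (capR I)) br /\ is_hull (U I (capR I)) br Hr ->
  realizable bw br Hw Hr.
Proof. by move=> [? ?] [? ?]; exists I. Qed.

(** * Remainder slopes among the larger slopes *)

(** Comparing multiplicities, the sequence of the rho is up to order a
    subsequence of that of the h, so the latter is a permutation of an
    extension of the former; j reads off the first br indices of it. *)
Lemma submset_slopes_inj bw br Hw Hr :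
  (slopes br Hr `<=` slopes bw Hw)%mset ->
  exists2 j : 'I_br -> 'I_bw, injective j &
    forall m : 'I_br, slope Hr m.+1 = slope Hw (j m).+1.
Proof.
rewrite /slopes; set sr := map _ _; set sw := map _ _ => /msubsetP sub.
have size_sr : size sr = br by rewrite size_map size_iota.
have size_sw : size sw = bw by rewrite size_map size_iota.
have [s s_sub sr_s] : exists2 s, subseq s sw & perm_eq sr s.
  by apply/count_subseqP => x; rewrite -!mset_seqE.
have [s' sw_s] := perm_to_subseq s_sub.
have /(perm_iotaP 0)[js] : perm_eq (sr ++ s') sw.
  by rewrite perm_sym (permPl sw_s) perm_cat2r perm_sym.
rewrite size_sw => js_iota srE.
have size_js : size js = (br + size s')%N.
  by rewrite -(size_map (nth 0 sw)) -srE size_cat size_sr.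
have lt_js (m : 'I_br) : (m < size js)%N.
  by rewrite size_js ltn_addr.
have js_lt (m : 'I_br) : (nth 0%N js m < bw)%N.
  have := mem_nth 0%N (lt_js m).
  by rewrite (perm_mem js_iota) mem_iota.
exists (fun m => Ordinal (js_lt m)) => [m1 m2 [] /eqP|m] /=.
  rewrite nth_uniq ?lt_js // => [/eqP/val_inj //|].
  by rewrite (perm_uniq js_iota) iota_uniq.
have : nth 0 (sr ++ s') m = nth 0 sw (nth 0%N js m).
  by rewrite srE (nth_map 0%N).
rewrite nth_cat size_sr ltn_ord.
by rewrite !(nth_map 0%N) ?size_iota ?nth_iota ?js_lt ?ltn_ord // !add1n.
Qed.

Section SubmultisetInstance.

Variables (bw br : nat) (Hw Hr : nat -> rat).
Hypotheses (target_w : is_target bw Hw) (target_r : is_target br Hr).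
Variable j : 'I_br -> 'I_bw.
Hypotheses (inj_j : injective j)
  (slope_j : forall m : 'I_br, slope Hr m.+1 = slope Hw (j m).+1).

Definition value_sub (i : 'I_bw) := slope Hw i.+1.
Definition weight_sub (i : 'I_bw) := if i \in codom j then 1%N else br.+1.

Definition capD_sub := (br.+1 + \sum_i weight_sub i)%N.

Lemma value_sub_ge0 i : 0 <= value_sub i.
Proof. exact: slope_ge0 target_w (ltn_ord i). Qed.

Lemma weight_sub_gt0 i : (0 < weight_sub i)%N.
Proof. by rewrite /weight_sub; case: ifP. Qed.

Lemma capR_sub_ltD : (br < capD_sub)%N.
Proof. by rewrite /capD_sub addSn ltnS leq_addr. Qed.

Lemma weight_sub_leD i : (weight_sub i <= capD_sub)%N.
Proof. by rewrite /capD_sub (bigD1 i) //= addnCA leq_addr. Qed.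

Definition submultiset_instance : instance :=
  Instance value_sub_ge0 weight_sub_gt0 capR_sub_ltD weight_sub_leD.

Lemma submultiset_realizable : realizable bw br Hw Hr.
Proof.
have [Hw0 _ _] := target_w; have [Hr0 _ _] := target_r.
apply: (@realizable_of_profiles submultiset_instance);
  apply: profile_of_bounds => //.
- move=> S _; have le_Sb : (#|S| <= bw)%N.
    by rewrite -[leqRHS]card_ord max_card.
  by rewrite (minn_idPl le_Sb); apply: greedy_bound.
- move=> n le_nb; exists (prefix_set bw n).
  split; [exact: card_prefix| |exact: sum_slope_prefix].
  rewrite /total_weight /= big_mkcond.
  apply: leq_trans (leq_addl _ _); apply: leq_sum => i _.
  by case: ifP.
- move=> S feasible.
  have S_codom i : i \in S -> i \in codom j.
    move=> iS; apply/negPn/negP => /negPf i_big.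
    move: feasible; rewrite /total_weight (bigD1 i) //= /weight_sub i_big; lia.
  have -> : S = j @: (j @^-1: S).
    apply/setP => i; apply/idP/imsetP => [iS|[m]].
      by have /codomP[m def_i] := S_codom i iS; exists m; rewrite // inE -def_i.
    by rewrite inE => ? ->.
  set T := _ @^-1: S; rewrite card_imset //.
  have le_Tb : (#|T| <= br)%N by rewrite -[leqRHS]card_ord max_card.
  rewrite (minn_idPl le_Tb) /total_value big_imset /=;
    last by move=> ? ? _ _ /inj_j.
  rewrite /value_sub; under eq_bigr => m _ do rewrite -slope_j.
  exact: greedy_bound.
- move=> n le_nb; exists (j @: prefix_set br n).
  rewrite card_imset // card_prefix //.
  rewrite /total_weight /total_value !big_imset /=; try by move=> ? ? _ _ /inj_j.
  rewrite /value_sub /weight_sub; split=> //.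
    under eq_bigr => m _ do rewrite codom_f.
    by rewrite sum1_card card_prefix.
  under eq_bigr => m _ do rewrite -slope_j.
  exact: sum_slope_prefix.
Qed.

End SubmultisetInstance.

(** * Large items completed by unit items *)

Section LargeItemInstance.

Variables (bw br : nat) (Hw Hr : nat -> rat).
Hypotheses (target_w : is_target bw Hw) (target_r : is_target br Hr).
Hypothesis dom : dominance bw br Hw Hr.
Hypothesis le_bwr : (bw - 1 <= br)%N.
Hypothesis slope_le :
  forall n : nat, (2 <= n <= bw)%N -> slope Hw n <= slope Hr n.-1.

Definition gap (n : nat) := Hw n.+1 - Hr n.

(* Large sizes lie between D - b_w + 1 and D; the term 2 b_w makes two of them
   exceed D, and the term b_r makes each exceed R = b_r. *)
Definition capD_large := (bw.*2 + br).+1.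

Definition value_large (x : 'I_br + 'I_bw) :=
  match x with inl m => slope Hr m.+1 | inr n => gap n end.
Definition weight_large (x : 'I_br + 'I_bw) :=
  match x with inl _ => 1%N | inr n => (capD_large - n)%N end.

(** The step from n to n+1 changes the gap by h_(n+2) - rho_(n+1), which the
    slope hypothesis makes nonpositive. *)
Lemma gap_antitone k n : (k <= n < bw)%N -> gap n <= gap k.
Proof.
case/andP; elim: n => [|n IHn] le_kn lt_nb.
  by move: le_kn; rewrite leqn0 => /eqP ->.
move: le_kn; rewrite leq_eqVlt => /predU1P[-> //|le_kn].
apply: le_trans (IHn le_kn (ltnW lt_nb)).
by have := @slope_le n.+2 lt_nb; rewrite /slope /gap /=; lra.
Qed.

Lemma value_large_ge0 x : 0 <= value_large x.
Proof.
case: x => [m|n] /=; first exact: slope_ge0 target_r (ltn_ord m).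
have lt_nb := ltn_ord n; have [_ incH _] := target_w.
have le_nbr : (n <= br)%N by lia.
rewrite subr_ge0 (le_trans (dom le_nbr)) // (minn_idPl (ltnW lt_nb)).
exact/ltW/incH.
Qed.

Lemma weight_large_gt0 x : (0 < weight_large x)%N.
Proof. by case: x => //= n; have := ltn_ord n; rewrite /capD_large; lia. Qed.

Lemma capR_large_ltD : (br < capD_large)%N.
Proof. by rewrite /capD_large ltnS leq_addl. Qed.

Lemma weight_large_leD x : (weight_large x <= capD_large)%N.
Proof. by case: x => //= n; rewrite leq_subr. Qed.

Definition large_item_instance : instance :=
  Instance value_large_ge0 weight_large_gt0 capR_large_ltD weight_large_leD.

Definition units (S : {set 'I_br + 'I_bw}) := [set m | inl m \in S].
Definition larges (S : {set 'I_br + 'I_bw}) := [set n | inr n \in S].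

Lemma big_units_larges (R : Type) (idx : R) (op : Monoid.com_law idx)
    (S : {set 'I_br + 'I_bw}) (F : 'I_br + 'I_bw -> R) :
  \big[op/idx]_(x in S) F x =
  op (\big[op/idx]_(m in units S) F (inl m))
     (\big[op/idx]_(n in larges S) F (inr n)).
Proof.
by rewrite big_sumType; congr (op _ _); apply: eq_bigl => ?; rewrite inE.
Qed.

Lemma card_units_larges (S : {set 'I_br + 'I_bw}) : #|S| = (#|units S| + #|larges S|)%N.
Proof. by rewrite -sum1_card big_units_larges !sum1_card. Qed.

Lemma card_units_le (S : {set 'I_br + 'I_bw}) : (#|units S| <= br)%N.
Proof. by rewrite -[leqRHS]card_ord max_card. Qed.

Lemma weight_units_larges (S : {set item large_item_instance}) :
  total_weight S = (#|units S| + \sum_(n in larges S) (capD_large - n))%N.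
Proof. by rewrite /total_weight big_units_larges /= sum1_card. Qed.

Lemma value_units_larges (S : {set item large_item_instance}) :
  total_value S = \sum_(m in units S) slope Hr m.+1 + \sum_(n in larges S) gap n.
Proof. by rewrite /total_value big_units_larges. Qed.

(** Two large items overflow D by the choice of D, and one of size D - n leaves
    exactly n units of capacity. *)
Lemma larges_feasible (S : {set item large_item_instance}) :
  (total_weight S <= capD_large)%N ->
  larges S = set0 \/ exists2 n, larges S = [set n] & (#|units S| <= n)%N.
Proof.
rewrite weight_units_larges => feasible.
have [->|[n nS]] := set_0Vmem (larges S); [by left | right; exists n].
  apply/eqP; rewrite eqEsubset sub1set nS andbT; apply/subsetP => n' n'S.
  rewrite inE; apply/negPn/negP => neq_n; move: feasible.
  rewrite (bigD1 n) //= (bigD1 n') /=; last by rewrite n'S.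
  by have := ltn_ord n; have := ltn_ord n'; rewrite /capD_large; lia.
move: feasible; rewrite (bigD1 n) //=.
by have := ltn_ord n; rewrite /capD_large; lia.
Qed.

Lemma larges_infeasible_r (S : {set item large_item_instance}) :
  (total_weight S <= br)%N -> larges S = set0.
Proof.
rewrite weight_units_larges => feasible.
have [//|[n nS]] := set_0Vmem (larges S).
move: feasible; rewrite (bigD1 n) //=.
by have := ltn_ord n; rewrite /capD_large; lia.
Qed.

Definition unit_prefix (n : nat) : {set 'I_br + 'I_bw} :=
  [set x : 'I_br + 'I_bw | if x is inl m then (m < n)%N else false].

Definition completed_large (k : 'I_bw) : {set 'I_br + 'I_bw} :=
  [set x : 'I_br + 'I_bw |
    match x with inl m => (m < k)%N | inr n => n == k end].

Lemma large_item_profile_r :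
  is_terminal_count (U large_item_instance br) br /\
  is_hull (U large_item_instance br) br Hr.
Proof.
have [Hr0 _ _] := target_r.
apply: profile_of_bounds => // [S /larges_infeasible_r no_large|n le_nb].
  rewrite value_units_larges card_units_larges no_large big_set0 cards0.
  rewrite addr0 addn0 (minn_idPl (card_units_le S)); exact: greedy_bound.
exists (unit_prefix n).
have unitsE : units (unit_prefix n) = prefix_set br n.
  by apply/setP => m; rewrite !inE.
have largesE : larges (unit_prefix n) = set0 by apply/setP => m; rewrite !inE.
rewrite card_units_larges weight_units_larges value_units_larges.
rewrite unitsE largesE cards0 !big_set0 card_prefix // sum_slope_prefix //.
by rewrite !addn0 addr0.
Qed.

Lemma large_item_profile_w :
  is_terminal_count (U large_item_instance capD_large) bw /\
  is_hull (U large_item_instance capD_large) bw Hw.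
Proof.
have [Hw0 _ _] := target_w; have [Hr0 _ _] := target_r.
apply: profile_of_bounds => // [S feasible|[_|k lt_kb]].
- rewrite value_units_larges card_units_larges.
  have greedy := greedy_bound (units S) target_r.
  have [->|[n -> le_Un]] := larges_feasible feasible.
    rewrite big_set0 cards0 addr0 addn0.
    exact: le_trans greedy (dom (card_units_le S)).
  have lt_nb := ltn_ord n.
  rewrite big_set1 cards1 addn1 (minn_idPl (leq_ltn_trans le_Un lt_nb)).
  have : gap n <= gap #|units S| by rewrite gap_antitone // le_Un.
  by rewrite {2}/gap; lra.
- exists set0; rewrite cards0 /total_weight /total_value !big_set0.
  by split.
- pose k' := Ordinal lt_kb; exists (completed_large k').
  have unitsE : units (completed_large k') = prefix_set br k.
    by apply/setP => m; rewrite !inE.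
  have largesE : larges (completed_large k') = [set k'].
    by apply/setP => m; rewrite !inE.
  have le_kbr : (k <= br)%N by lia.
  rewrite card_units_larges weight_units_larges value_units_larges.
  rewrite unitsE largesE cards1 !big_set1 card_prefix // sum_slope_prefix //=.
  rewrite addn1 /gap; split=> //; last by ring.
  by rewrite /capD_large; lia.
Qed.

Lemma large_item_realizable : realizable bw br Hw Hr.
Proof.
by apply: (@realizable_of_profiles large_item_instance);
  [exact: large_item_profile_w | exact: large_item_profile_r].
Qed.

End LargeItemInstance.

Theorem theorem4p2 (bw br : nat) (Hw Hr : nat -> rat)
  (target_w : is_target bw Hw) (target_r : is_target br Hr)
  (dom : dominance bw br Hw Hr)
  (cond : conditionA bw br Hw Hr \/ conditionB bw br Hw Hr) :
  realizable bw br Hw Hr.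
Proof.
case: cond => [[_ /submset_slopes_inj[j inj_j slope_j]]|[le_bwr slope_le]].
  exact: submultiset_realizable slope_j.
exact: large_item_realizable.
Qed.
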